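(* Every eigenfunction of $K$ (in particular each of the functions $\phi_1,\phi_2,\phi_3,\ldots$) is continuous on $[0,1]$.
   Context: Let $K:[0,1]\times[0,1]\to\mathbb R$ be defined by $K(x,y)=\frac12-\{(xy)^{-1}\}$ if $0<x,y\le 1$, and $K(x,y)=0$ if $0\le x,y\le1$ and $xy=0$, where $\{\alpha\}=\alpha-\lfloor\alpha\rfloor$. Let $L^2([0,1])$ denote the space of real-valued Lebesgue measurable square-integrable functions on $[0,1]$, with $\langle f,g\rangle=\int_0^1 f(x)g(x)\,dx$ and $\|f\|=\langle f,f\rangle^{1/2}$. A function $\phi$ is an eigenfunction of $K$ (with eigenvalue $\lambda\in\mathbb R$) if $\phi\in L^2([0,1])$, $\|\phi\|>0$, and $\phi(x)=\lambda\int_0^1 K(x,y)\phi(y)\,dy$ for every $x\in[0,1]$. Let $\phi_1,\phi_2,\ldots$ be a maximal orthonormal system in $L^2([0,1])$ of eigenfunctions of $K$, $\phi_j$ having the nonzero real eigenvalue $\lambda_j$, numbered so that $0<|\lambda_1|\le|\lambda_2|\le\cdots$ and $\lambda_j\ge\lambda_{j+1}$ whenever $|\lambda_j|=|\lambda_{j+1}|$. *)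

(* Defs.v *)
From HB Require Import structures.
From mathcomp Require Import all_boot all_order all_algebra.
From mathcomp Require Import all_classical all_reals all_analysis.
Set Implicit Arguments. Unset Strict Implicit. Unset Printing Implicit Defensive.
Import Order.TTheory GRing.Theory Num.Theory.
Import numFieldNormedType.Exports.
Local Open Scope classical_set_scope.
Local Open Scope ring_scope.

Definition fracpart {R : realType} (a : R) : R := a - (Num.floor a)%:~R.

(* The kernel K(x,y) = 1/2 - {(xy)^-1} for 0 < x,y <= 1, and 0 when xy = 0.
   Only its values on [0,1]x[0,1] matter below. *)
Definition Kker {R : realType} (x y : R) : R :=
  if (0 < x) && (0 < y) then 2^-1 - fracpart ((x * y)^-1) else 0.

(* R equipped with the Lebesgue (= completed, Caratheodory) sigma-algebra;
   its carrier is convertible to R. *)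
Definition LebR (R : realType) : measurableType _ :=
  caratheodory_type (@lebesgue_stieltjes_measure R idfun)^*%mu.

Notation leb := (@completed_lebesgue_measure _).

Definition I01 {R : realType} : set (LebR R) := `[0%R, 1%R].

Definition is_eigenfunction {R : realType} (phi : R -> R) (lam : R) : Prop :=
  [/\ measurable_fun (@I01 R) (phi : LebR R -> R),
      leb.-integrable (@I01 R) (fun x : LebR R => (phi x ^+ 2)%:E),
      (0 < \int[leb]_(x in @I01 R) (phi x ^+ 2)%:E)%E
    & forall x : R, x \in `[0%R, 1%R] ->
        phi x = lam * Rintegral leb (@I01 R)
                        (fun y : LebR R => Kker x y * phi y)].

(* Main.v *)
Require Import Defs.
From HB Require Import structures.
From mathcomp Require Import all_boot all_order all_algebra.
From mathcomp Require Import all_classical all_reals all_analysis.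
From mathcomp Require Import measurable_realfun ring lra.
Import Order.TTheory GRing.Theory Num.Theory.
Import numFieldNormedType.Exports.
Local Open Scope classical_set_scope.
Local Open Scope ring_scope.

(** Let [T x] be the integral of [K(x,y) phi(y)] over [0,1], so that
    [phi = lam T] on [0,1].  At [x > 0], [K(.,y)] is continuous except when
    [1/(xy)] is an integer, which happens for countably many [y] only, and
    dominated convergence gives the continuity of [T].  At [0], where [T]
    vanishes, one needs a Riemann-Lebesgue lemma: [K(x,.)] oscillates with mean
    almost zero as [x] tends to [0+].  Between consecutive points [1/(xk)] and
    [1/(x(k+1))] of the unit interval the kernel is within [x] of an affine
    function with zero integral, hence its integral against a continuous
    function is small; the integrable case follows by density in [L^1]. *)

(** * Comparison of the Borel and the completed Lebesgue measure *)

Section completed_lebesgue.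
Context {R : realType}.

Local Notation leb_type := (caratheodory_type (R:=R) (@wlength R idfun)^*%mu).
Local Notation cmu := (@completed_lebesgue_measure R).
Local Notation mu := (@lebesgue_measure R).

(** [LebR] is built from the outer measure of Lebesgue measure, [leb] from that of interval lengths.
    A cover by intervals is a Borel cover with the same sum; conversely, the outer measure of
    interval lengths is countably subadditive over any Borel cover. *)
Lemma mu_ext_lebesgue_measure (A : set R) :
  (mu^*%mu A = (@wlength R idfun)^*%mu A)%E.
Proof.
apply/eqP; rewrite eq_le; apply/andP; split.
- apply/ereal_infP => _ [F [mF AF] <-].
  apply: ereal_inf_lbound; exists F.
    by split=> // i; apply: sub_sigma_algebra; exact: mF.
  by apply: eq_eseriesr => i _; exact: measurable_mu_extE.
- apply/ereal_infP => _ [F [mF AF] <-].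
  apply: (le_trans (@le_mu_ext _ _ _ (@wlength R idfun) _ _ AF)).
  exact: (outer_measure_sigma_subadditive (@wlength R idfun)^*%mu).
Qed.

(** Bridges two sigma-algebras: [is_eigenfunction] states measurability over [LebR], whereas its
    integrals live on the domain of [leb]. Equal outer measures have the same Caratheodory sets. *)
Lemma measurable_fun_LebR (D : set R) (f : R -> R) :
  measurable_fun (D : set (LebR R)) (f : LebR R -> R) ->
  measurable_fun (D : set leb_type) (f : leb_type -> R).
Proof.
have E (A : set R) :
    caratheodory_measurable mu^*%mu A =
    caratheodory_measurable (@wlength R idfun)^*%mu A.
  rewrite /caratheodory_measurable; congr (forall X, _); apply/funext => X.
  by rewrite !mu_ext_lebesgue_measure.
move=> mf mD B mB.
have mD' : caratheodory_measurable mu^*%mu D by rewrite E; exact: mD.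
have := mf mD' B mB.
change (caratheodory_measurable mu^*%mu (D `&` f @^-1` B) ->
  caratheodory_measurable (@wlength R idfun)^*%mu (D `&` f @^-1` B)).
by rewrite E.
Qed.

Lemma measurable_completed (A : set R) :
  measurable A -> measurable (A : set leb_type).
Proof. exact: sub_caratheodory. Qed.

Lemma measurable_fun_idfun_completed :
  measurable_fun [set: leb_type] (idfun : leb_type -> R).
Proof. by move=> _ B mB; rewrite setTI; exact: measurable_completed. Qed.

Lemma measurable_fun_completed (D : set R) (f : R -> R) : measurable D ->
  measurable_fun D f -> measurable_fun (D : set leb_type) (f : leb_type -> R).
Proof. by move=> mD mf _ B mB; apply: measurable_completed; exact: mf. Qed.

(** The identity from the completed line to the Borel line is measurable and pushes the completed
    measure forward to Lebesgue measure, so a change of variables applies. *)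
Lemma Rintegral_completed (D : set R) (f : R -> R) :
  measurable D -> measurable_fun [set: R] f ->
  cmu.-integrable (D : set leb_type) (EFin \o f : leb_type -> \bar R) ->
  Rintegral cmu D f = \int[mu]_(x in D) f x.
Proof.
move=> mD mf intf; congr fine.
have := @integral_pushforward _ _ leb_type (measurableTypeR R) R idfun
  measurable_fun_idfun_completed cmu D (EFin \o f) _ intf mD.
move=> /= <-; last exact/measurable_EFinP.
pose nu : {measure set (measurableTypeR R) -> \bar R} :=
  pushforward cmu (idfun : leb_type -> measurableTypeR R).
exact: (@eq_measure_integral _ (measurableTypeR R) R D mu
  (nu measurable_fun_idfun_completed)).
Qed.

Lemma completed_countable0 (A : set R) : countable A -> cmu.-negligible A.
Proof.
move=> cA; exists A; split => //; last first.
  exact: countable_lebesgue_measure0.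
apply: measurable_completed.
exact: (countable_measurable (@measurable_set1 R)).
Qed.

End completed_lebesgue.

(** * Bound, measurability and continuity of the kernel *)

Section kernel.
Context {R : realType}.
Implicit Types x y : R.

Lemma Kker_le0 x y : x <= 0 -> Kker x y = 0.
Proof. by move=> x0; rewrite /Kker ltNge x0. Qed.

Lemma Kker_pos x y : 0 < x -> 0 < y ->
  Kker x y = 2^-1 - ((x * y)^-1 - (Num.floor (x * y)^-1)%:~R).
Proof. by move=> x0 y0; rewrite /Kker x0 y0. Qed.

Lemma normr_Kker_le x y : `|Kker x y| <= 2^-1.
Proof.
rewrite /Kker; case: ifPn => [_|_]; last by rewrite normr0 invr_ge0.
have := ge_floor (x * y)^-1; have := floorD1_gt (x * y)^-1.
rewrite /fracpart intrD ler_norml; lra.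
Qed.

Lemma measurable_Kker x : measurable_fun [set: R] (Kker x).
Proof.
have [x0|x0] := leP x 0.
  rewrite (_ : Kker x = cst 0)//; apply/funext => y.
  exact: Kker_le0.
pose F (t : R) : R := (Num.floor t)%:~R.
have mF : measurable_fun [set: R] F.
  by apply: nondecreasing_measurable => // s t st; rewrite ler_int le_floor.
have mI : measurable_fun (`]0, +oo[%classic : set R) (fun y => (x * y)^-1).
  apply: open_continuous_measurable_fun; first exact: interval_open.
  move=> y; rewrite inE/= in_itv/= andbT => y0.
  apply: continuousV; first by rewrite mulf_neq0// gt_eqF.
  by apply: cvgM; [exact: cvg_cst|exact: cvg_id].
have mpos : measurable (`]0, +oo[%classic : set R) by exact: measurable_itv.
rewrite (_ : Kker x =
    (fun y => 2^-1 - ((x * y)^-1 - F (x * y)^-1)) \_ `]0, +oo[); last first.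
  apply/funext => y; rewrite patchE; case: ifPn => [|yn].
    by rewrite inE/= in_itv/= andbT => y0; rewrite Kker_pos.
  rewrite /Kker x0 /=; case: ifPn => // y0.
  by move: yn; rewrite notin_setE/= in_itv/= y0.
apply: (measurable_restrictT _ mpos).1.
apply: measurable_funB => //; apply: measurable_funB => //.
exact: measurableT_comp.
Qed.

(** Away from the excluded [y] the number [1/(xy)] is not an integer, so the floor is constant
    around it. The sequential form is the one that dominated convergence asks for. *)
Lemma cvg_Kkerl (x y : R) (u : R^nat) : 0 < x ->
  (forall k : int, y != (x * k%:~R)^-1) ->
  u @ \oo --> x -> Kker (u n) y @[n --> \oo] --> Kker x y.
Proof.
move=> x0 yk ux; have [y0|y0] := leP y 0.
  have E z : Kker z y = 0 by rewrite /Kker (ltNge 0 y) y0 andbF.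
  rewrite E (_ : (fun n => _) = cst 0); first exact: cvg_cst.
  by apply/funext => n; exact: E.
have xy0 : x * y != 0 by rewrite mulf_neq0// gt_eqF.
have cu : (u n * y)^-1 @[n --> \oo] --> (x * y)^-1.
  by apply: cvgV => //; apply: cvgM => //; exact: cvg_cst.
pose m : int := Num.floor (x * y)^-1.
have mlt : m%:~R < (x * y)^-1.
  rewrite lt_neqAle ge_floor andbT; apply/negP => /eqP mE.
  have /negP := yk m; apply; apply/eqP.
  by rewrite mE; field; rewrite gt_eqF//= gt_eqF.
have ltm : (x * y)^-1 < (m + 1)%:~R by exact: floorD1_gt.
have : 2^-1 - ((u n * y)^-1 - m%:~R) @[n --> \oo] --> Kker x y.
  rewrite Kker_pos//; apply: cvgB; first exact: cvg_cst.
  by apply: cvgB => //; exact: cvg_cst.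
apply: cvg_trans; apply: near_eq_cvg; near=> n.
have un0 : 0 < u n by near: n; exact: cvgr_gt ux _ x0.
rewrite Kker_pos//; congr (_ - (_ - _%:~R)); apply/esym/floor_def.
apply/andP; split.
  by apply/ltW; near: n; exact: cvgr_gt cu _ mlt.
by near: n; exact: cvgr_lt cu _ ltm.
Unshelve. all: by end_near. Qed.

End kernel.

(** * A Riemann-Lebesgue lemma for the kernel as [x] tends to [0] from the right *)

Section riemann_lebesgue.
Context {R : realType}.
Local Notation mu := (@lebesgue_measure R).

Lemma normr_Rintegral_le_cst d (T : measurableType d)
    (nu : {measure set T -> \bar R}) (D : set T) (f : T -> R) (B : R) :
  measurable D -> (nu D < +oo)%E -> nu.-integrable D (EFin \o f) ->
  (forall t, D t -> `|f t| <= B) ->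
  `|\int[nu]_(t in D) f t| <= B * fine (nu D).
Proof.
move=> mD Dfin intf fB; apply: (le_trans (le_normr_Rintegral mD intf)).
rewrite -Rintegral_cst//; apply: le_Rintegral => //.
  exact: integrable_norm.
apply: measurable_bounded_integrable => //.
by exists `|B|; split; [exact: num_real|move=> c Bc t _; exact: ltW].
Qed.

Lemma lebesgue_measure_itv_fin (a b : R) (c d : bool) : a <= b ->
  (mu [set` Interval (BSide c a) (BSide d b)] < +oo)%E /\
  fine (mu [set` Interval (BSide c a) (BSide d b)]) = b - a.
Proof.
move=> ab; rewrite lebesgue_measure_itv/= lte_fin.
case: (ltP a b) => [_|ba]; first by rewrite -EFinB ltry.
by split=> //; apply/eqP; rewrite eq_sym subr_eq0 eq_le ab ba.
Qed.

Lemma Rintegral_centered (a b : R) : a < b ->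
  \int[mu]_(y in `]a, b]) (y - (a + b) / 2) = 0.
Proof.
move=> ab.
have ci : continuous (fun y : R => y - (a + b) / 2).
  by move=> y; apply: cvgB; [exact: cvg_id|exact: cvg_cst].
have ii : mu.-integrable `[a, b] (EFin \o (fun y => y - (a + b) / 2)).
  apply: continuous_compact_integrable; first exact: segment_compact.
  exact: continuous_subspaceT.
rewrite Rintegral_itv_obnd_cbnd; last first.
  by apply: integrableS ii => //; exact: subset_itv_oc_cc.
(* This primitive is symmetric about the midpoint, so its values at [a] and [b] cancel. *)
pose F (y : R) := 2^-1 * (y - (a + b) / 2) ^+ 2.
have dF (y : R) : is_derive y 1 F (y - (a + b) / 2).
  rewrite /F; apply: is_derive_eq.
  by rewrite /GRing.scale/=; field.
have cF : continuous F.
  move=> y; apply: differentiable_continuous; apply/derivable1_diffP.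
  exact: ex_derive.
rewrite /Rintegral (@continuous_FTC2 _ _ F)//=.
- by rewrite /F; lra.
- exact: continuous_subspaceT.
- split.
  + by move=> y _; exact: ex_derive.
  + exact/cvg_at_right_filter/cF.
  + exact/cvg_at_left_filter/cF.
- by move=> y _; rewrite derive1E derive_val.
Qed.

(** Only [y] is confined to the segment; [z] may leave it, as [g] is continuous on the whole line.
    Compactness is used in its filter form, the modulus [d] tending to [0] from the right. *)
Lemma unif_continuous_segment (g : R -> R) (a b e : R) :
  continuous g -> 0 < e ->
  exists2 d : R, 0 < d & forall y z, y \in `[a, b] -> `|y - z| < d ->
    `|g y - g z| < e.
Proof.
move=> cg e0.
have /compact_near_coveringP cK := @segment_compact R a b.
have := cK _ (0^'+ : set_system R)
  (fun d y => forall z, `|y - z| < d -> `|g y - g z| < e).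
have e20 : 0 < e / 2 by rewrite divr_gt0.
case=> [y yab|r /= r0 H].
  have /cvgrPdist_lt /(_ _ e20) [r /= r0 H] := cg y.
  (* Half of the radius [r] is spent on [w], the other half on [d], so that [z] stays within [r] of
     [y]. *)
  exists (ball y (r / 2), [set d | d < r / 2]).
    split => /=; first by apply: nbhsx_ballx; rewrite divr_gt0.
    by apply: nbhs_right_lt; rewrite divr_gt0.
  move=> [w d] /= [+ dr] z wz; rewrite -ball_normE /= => yw.
  have gyw : `|g y - g w| < e / 2 by apply: H => /=; lra.
  have gyz : `|g y - g z| < e / 2.
    by apply: H => /=; have := ler_distD w y z; lra.
  by have := ler_distD (g y) (g w) (g z); rewrite (distrC (g w) (g y)); lra.
exists (r / 2); first by rewrite divr_gt0.
move=> y z yab yz; apply: (H (r / 2)) => //=.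
- by rewrite sub0r normrN ger0_norm; lra.
- by rewrite divr_gt0.
Qed.

Lemma integrable_mul_bounded d (T : measurableType d)
    (nu : {measure set T -> \bar R}) (D : set T) (h f : T -> R) :
  measurable D -> measurable_fun D h -> (forall t, `|h t| <= 2^-1) ->
  nu.-integrable D (EFin \o f) ->
  nu.-integrable D (EFin \o (fun t => h t * f t)).
Proof.
move=> mD mh h2 intf; apply: (le_integrable mD _ _ intf).
  apply/measurable_EFinP; apply: measurable_funM => //.
  by apply/measurable_EFinP; case/integrableP : intf.
move=> t _ /=; rewrite lee_fin normrM ler_piMl// (le_trans (h2 t))//; lra.
Qed.

(* On the interval where [1/(xy)] lies in [[k, k+1[], the kernel is within [x]
   of the affine function of [y] going from [-1/2] to [1/2]. *)
Lemma Kker_affine_approx (x y : R) (k : nat) : 0 < x -> x^-1 <= k%:R ->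
  (x * k.+1%:R)^-1 < y -> y <= (x * k%:R)^-1 ->
  let L := x * k%:R * k.+1%:R *
    (y - ((x * k.+1%:R)^-1 + (x * k%:R)^-1) / 2) in
  `|Kker x y - L| <= x /\ `|L| <= 2^-1.
Proof.
move=> x0 xk ylo yhi.
have k0 : 0 < k%:R :> R by rewrite (lt_le_trans _ xk)// invr_gt0.
have k10 : 0 < k.+1%:R :> R by [].
have xk10 : 0 < x * k.+1%:R by exact: mulr_gt0.
have xk0 : 0 < x * k%:R by exact: mulr_gt0.
have y0 : 0 < y by rewrite (lt_trans _ ylo)// invr_gt0.
move: ylo yhi; rewrite -(ltr_pM2r xk10) mulVf ?gt_eqF// => ylo.
rewrite -(ler_pM2r xk0) mulVf ?gt_eqF// => yhi.
have kE : k.+1%:R = k%:R + 1 :> R by rewrite natr1.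
rewrite kE in ylo k10 xk10 *.
set K : R := k%:R in xk k0 xk0 ylo yhi kE k10 xk10 *.
have t0 : 0 < x * y by exact: mulr_gt0.
have tV : (x * y)^-1 < K + 1.
  by rewrite -(ltr_pM2r t0) mulVf ?gt_eqF//; lra.
have tV' : K <= (x * y)^-1.
  by rewrite -(ler_pM2r t0) mulVf ?gt_eqF//; lra.
have -> : Kker x y = 2^-1 - ((x * y)^-1 - K).
  rewrite Kker_pos// (_ : Num.floor _ = k%:Z)// ; apply: floor_def.
  by rewrite intrD -!pmulrn tV tV'.
have LE : x * K * (K + 1) * (y - ((x * (K + 1))^-1 + (x * K)^-1) / 2) =
    K * ((K + 1) * (x * y)) - K - 2^-1.
  by field; rewrite !gt_eqF.
rewrite /= LE; split; last first.
  have p1 : K * ((K + 1) * (x * y)) <= K + 1.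
    by rewrite mulrCA; apply: ler_piMr; [exact: ltW|lra].
  have p2 : K <= K * ((K + 1) * (x * y)) by apply: ler_peMr; [exact: ltW|lra].
  by rewrite ler_norml; lra.
have KV : K^-1 <= x by rewrite invf_ple ?posrE.
(* The error factors: the first factor is a fractional part, and the second lies between [0] and
   [1/K], which is at most [x]. *)
have -> : 2^-1 - ((x * y)^-1 - K) - (K * ((K + 1) * (x * y)) - K - 2^-1) =
    ((x * y)^-1 - K) * ((K + 1) * (x * y) - 1).
  by field; rewrite !gt_eqF.
have q0 : 0 <= (K + 1) * (x * y) - 1 by lra.
have qV : (K + 1) * (x * y) - 1 <= x.
  apply: le_trans KV; rewrite -(ler_pM2l k0) mulfV ?gt_eqF//.
  have : K * ((K + 1) * (x * y)) <= K + 1.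
    by rewrite mulrCA; apply: ler_piMr; [exact: ltW|lra].
  lra.
rewrite ger0_norm; last by rewrite mulr_ge0//; lra.
by apply: le_trans qV; rewrite ler_piMl//; lra.
Qed.

(** The affine approximation [L] has zero integral, so subtracting [g b * L] changes nothing. What
    remains is [(Kker x y - L) * g y + L * (g y - g b)], whose terms are at most [x * M] and
    [e / 2], because the interval is no longer than [x]. *)
Lemma Kker_piece_bound (g : R -> R) (x M e : R) (k : nat) : 0 < x ->
  x^-1 <= k%:R -> continuous g ->
  (forall y, y \in `[0, 1] -> `|g y| <= M) ->
  (forall y z, y \in `[0, 1] -> `|y - z| <= x -> `|g y - g z| <= e) ->
  `|\int[mu]_(y in `](x * k.+1%:R)^-1, (x * k%:R)^-1]) (Kker x y * g y)| <=
  (x * M + e / 2) * ((x * k%:R)^-1 - (x * k.+1%:R)^-1).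
Proof.
move=> x0 xk cg gM ge.
have k0 : 0 < k%:R :> R by rewrite (lt_le_trans _ xk)// invr_gt0.
have xk10 : 0 < x * k.+1%:R by exact: mulr_gt0.
have xk0 : 0 < x * k%:R by exact: mulr_gt0.
set a := (x * k.+1%:R)^-1; set b := (x * k%:R)^-1.
have a0 : 0 < a by rewrite invr_gt0.
have ab : a < b by rewrite ltf_pV2 ?posrE// ltr_pM2l// ltr_nat.
have b1 : b <= 1.
  by rewrite invf_le1// mulrC -ler_pdivrMr// div1r.
(* The length is [1/(xk(k+1))], where [1/(xk)] is at most [1] and [1/(k+1)] at most [x]. *)
have ba : b - a <= x.
  have -> : b - a = b * k.+1%:R^-1.
    by rewrite /a /b -natr1; field; rewrite natr1 !gt_eqF.
  rewrite (@le_trans _ _ k.+1%:R^-1)// ?ler_piMl// invf_ple ?posrE//.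
  by rewrite (le_trans xk)// ler_nat.
have [mfin mE] := lebesgue_measure_itv_fin a b false false (ltW ab).
rewrite -mE.
have ig : mu.-integrable `]a, b] (EFin \o g).
  apply: (@integrableS _ _ _ mu `[a, b]) => //; first exact: subset_itv_oc_cc.
  apply: continuous_compact_integrable; first exact: segment_compact.
  exact: continuous_subspaceT.
have iKg : mu.-integrable `]a, b] (EFin \o (fun y => Kker x y * g y)).
  apply: integrable_mul_bounded => //; last exact: normr_Kker_le.
  by apply: measurable_funTS; exact: measurable_Kker.
pose s := x * k%:R * k.+1%:R.
have il : mu.-integrable `]a, b] (EFin \o (fun y => y - (a + b) / 2)).
  apply: (@integrableS _ _ _ mu `[a, b]) => //; first exact: subset_itv_oc_cc.
  apply: continuous_compact_integrable; first exact: segment_compact.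
  apply: continuous_subspaceT => y.
  by apply: cvgB; [exact: cvg_id|exact: cvg_cst].
have isl : mu.-integrable `]a, b]
    (EFin \o (fun y => (g b * s) * (y - (a + b) / 2))).
  exact: (@integrableZl _ _ _ mu `]a, b] (measurable_itv _) (g b * s) _ il).
have -> : \int[mu]_(y in `]a, b]) (Kker x y * g y) =
    \int[mu]_(y in `]a, b]) (Kker x y * g y - (g b * s) * (y - (a + b) / 2)).
  by rewrite RintegralB// RintegralZl// Rintegral_centered// mulr0 subr0.
apply: normr_Rintegral_le_cst => //.
  exact: integrableB iKg isl.
move=> y /=; rewrite in_itv/= => /andP[ay yb].
have [] := @Kker_affine_approx x y k x0 xk ay yb; rewrite -/a -/b -/s /=.
set L := s * _ => KL L2.
have y01 : y \in `[0, 1].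
  by rewrite in_itv/= (le_trans (ltW a0) (ltW ay)) (le_trans yb).
have -> : Kker x y * g y - g b * s * (y - (a + b) / 2) =
    (Kker x y - L) * g y + L * (g y - g b) by rewrite /L; ring.
apply: (le_trans (ler_normD _ _)); rewrite normrM (normrM L); apply: lerD.
  by apply: ler_pM => //; exact: gM.
rewrite [X in X <= _]mulrC; apply: ler_pM => //; apply: ge => //.
by rewrite ler0_norm; lra.
Qed.

(** There are three ranges. Near [0] and near [1] an interval of length at most [x] costs
    [M / 2 * x] by the trivial bound. In between, [Kker_piece_bound] gives at most [x * M + e / 2],
    since the pieces have total length at most [1]. *)
Lemma Kker_bound_continuous (g : R -> R) (x M e : R) : 0 < x ->
  continuous g ->
  (forall y, y \in `[0, 1] -> `|g y| <= M) ->
  (forall y z, y \in `[0, 1] -> `|y - z| <= x -> `|g y - g z| <= e) ->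
  `|\int[mu]_(y in `[0, 1]) (Kker x y * g y)| <= 2 * M * x + e / 2.
Proof.
move=> x0 cg gM ge.
have M0 : 0 <= M by rewrite (le_trans _ (gM 0 _))// in_itv/= lexx ler01.
have e0 : 0 <= e.
  rewrite (le_trans _ (ge 0 0 _ _))// ?subrr ?normr0 ?ltW//.
  by rewrite in_itv/= lexx ler01.
pose h y := Kker x y * g y.
have ih : mu.-integrable `[0, 1] (EFin \o h).
  apply: integrable_mul_bounded => //.
  - by apply: measurable_funTS; exact: measurable_Kker.
  - exact: normr_Kker_le.
  - apply: continuous_compact_integrable; first exact: segment_compact.
    exact: continuous_subspaceT.
have hM y : y \in `[0, 1] -> `|h y| <= M / 2.
  by move=> y01; rewrite normrM mulrC ler_pM// ?gM// normr_Kker_le.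
pose I t := \int[mu]_(y in `[0, t]) h y.
have ihs t : t <= 1 -> mu.-integrable `[0, t] (EFin \o h).
  by move=> t1; apply: integrableS ih => //; exact: subset_itvl.
have IB t s : 0 <= t -> t <= s -> s <= 1 ->
    I s - I t = \int[mu]_(y in `]t, s]) h y.
  by move=> t0 ts s1; apply: Rintegral_itvB; rewrite ?bnd_simp//; exact: ihs.
have IBM t s : 0 <= t -> t <= s -> s <= 1 -> `|I s - I t| <= M / 2 * (s - t).
  move=> t0 ts s1; rewrite IB//.
  have [mfin <-] := lebesgue_measure_itv_fin t s false false ts.
  apply: normr_Rintegral_le_cst => //.
    by apply: integrableS ih => // y /=; rewrite !in_itv/=; lra.
  by move=> y /=; rewrite in_itv/= => y01; apply: hM; rewrite in_itv/=; lra.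
have I0 : I 0 = 0 by rewrite /I set_itv1 Rintegral_set1.
pose c n := (x * n%:R)^-1.
(* By the convention for inverses [c 0] is [0], so monotonicity starts at index [1]. *)
have cd n m : (0 < n)%N -> (n <= m)%N -> c m <= c n.
  move=> n0 nm; rewrite lef_pV2 ?posrE ?mulr_gt0// ?ltr0n// ?(leq_trans n0)//.
  by rewrite ler_pM2l// ler_nat.
have c0 n : 0 <= c n by rewrite invr_ge0 mulr_ge0// ltW.
(* The least integer above [1/x]: [c N] is the largest breakpoint below [1]. *)
pose N := (Num.trunc x^-1).+1.
have N1 : x^-1 < N%:R by exact: truncnS_gt.
have N2 : N%:R <= x^-1 + 1.
  rewrite /N -natr1 lerD2r.
  have xV0 : 0 <= x^-1 by rewrite invr_ge0 ltW.
  by have /andP[] := truncn_itv xV0.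
have xN : 1 < x * N%:R by rewrite mulrC -ltr_pdivrMr// div1r.
have cN1 : c N <= 1 by rewrite invf_le1 ?(lt_trans ltr01)// ltW.
(* The bound is proportional to the length covered, so it telescopes and stays bounded as [m]
   grows. *)
have ItoN m : `|I (c N) - I (c (N + m)%N)| <=
    (x * M + e / 2) * (c N - c (N + m)%N).
  elim: m => [|m IH]; first by rewrite addn0 !subrr normr0 mulr0.
  rewrite -(subrKA (I (c (N + m)%N))) (le_trans (ler_normD _ _))//.
  rewrite -(subrKA (c (N + m)%N) (c N)) [leRHS]mulrDr lerD//.
  have cS : c (N + m.+1)%N <= c (N + m)%N by apply: cd => //; rewrite addnS.
  have c1 : c (N + m)%N <= 1.
    by apply: le_trans cN1; apply: cd => //; rewrite leq_addr.
  rewrite IB// addnS; apply: Kker_piece_bound => //.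
  by rewrite (le_trans (ltW N1))// ler_nat leq_addr.
(* An index [n] beyond [x ^- 2] makes [1/(xn)] smaller than [x]. *)
pose m := (Num.trunc (x ^- 2)).+1.
have cm : c (N + m)%N <= x.
  have x2m : x ^- 2 < (N + m)%:R.
    by rewrite (lt_le_trans (truncnS_gt _))// ler_nat leq_addl.
  rewrite invf_ple ?posrE//; last by rewrite mulr_gt0// ltr0n.
  rewrite -(ler_pM2l (_ : 0 < x^-1)) ?invr_gt0// mulKf ?gt_eqF//.
  by rewrite -invfM -expr2 ltW.
have cNm : c (N + m)%N <= c N by apply: cd => //; rewrite leq_addr.
(* Here [x * N] is at most [1 + x], and [1/(1 + x)] is at least [1 - x]. *)
have c1N : 1 - c N <= x.
  have : c N * (x * N%:R) = 1 by rewrite mulVf// gt_eqF// (lt_trans ltr01).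
  have : x * N%:R <= 1 + x.
    rewrite (le_trans (_ : _ <= x * (x^-1 + 1)))// ?ler_pM2l//.
    by rewrite mulrDr mulfV ?gt_eqF// mulr1.
  have := c0 N; nra.
have -> : \int[mu]_(y in `[0, 1]) (Kker x y * g y) =
    (I 1 - I (c N)) + (I (c N) - I (c (N + m)%N)) + (I (c (N + m)%N) - I 0).
  by rewrite I0 /I /h; ring.
have b1 := IBM _ _ (c0 N) cN1 (lexx 1).
have b2 := ItoN m.
have b3 := IBM _ _ (lexx 0) (c0 (N + m)%N) (le_trans cNm cN1).
apply: (le_trans (ler_normD _ _)).
have := ler_normD (I 1 - I (c N)) (I (c N) - I (c (N + m)%N)).
have : M / 2 * (1 - c N) <= M / 2 * x by rewrite ler_wpM2l// divr_ge0.
have : M / 2 * (c (N + m)%N - 0) <= M / 2 * x.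
  by rewrite subr0 ler_wpM2l// divr_ge0.
have : (x * M + e / 2) * (c N - c (N + m)%N) <= x * M + e / 2.
  rewrite ler_piMr//; last by have := c0 (N + m)%N; lra.
  by rewrite addr_ge0 ?divr_ge0// mulr_ge0// ltW.
lra.
Qed.

Lemma cvg_Kker_continuous (g : R -> R) : continuous g ->
  \int[mu]_(y in `[0, 1]) (Kker x y * g y) @[x --> 0^'+] --> 0.
Proof.
move=> cg; apply/cvgrPdist_le => e e0.
have [d d0 ge] := @unif_continuous_segment g 0 1 e cg e0.
have [M M0 gM] : exists2 M : R, 0 < M & forall y, y \in `[0, 1] -> `|g y| <= M.
  have : {within `[0, 1], continuous g} by exact: continuous_subspaceT.
  move=> /continuous_compact /(_ (@segment_compact _ _ _)).
  move=> /compact_bounded [M [_ gM]].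
  exists (`|M| + 1); first by rewrite ltr_wpDl.
  move=> y y01; apply: gM; first by rewrite ltr_pwDr// ler_norm.
  by exists y.
near=> x.
have x0 : 0 < x by near: x; exact: nbhs_right_gt.
have xd : x < d by near: x; exact: nbhs_right_lt.
have xM : 2 * M * x <= e / 2.
  have : x < e / (4 * M).
    by near: x; apply: nbhs_right_lt; rewrite divr_gt0 ?mulr_gt0.
  by rewrite ltr_pdivlMr ?mulr_gt0//; lra.
rewrite sub0r normrN.
apply: (le_trans (@Kker_bound_continuous g x M e x0 cg gM _)).
  by move=> y z y01 yz; apply/ltW/ge => //; apply: le_lt_trans xd.
lra.
Unshelve. all: by end_near. Qed.

(** The bound [1/2] on the kernel is uniform in [x], so replacing [f] by a continuous [g_ n] within
    [e] of it in $L^1$ costs at most [e / 2], whatever [x] is. *)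
Lemma cvg_Kker_integrable (f : R -> R) :
  mu.-integrable `[0, 1] (EFin \o f) ->
  \int[mu]_(y in `[0, 1]) (Kker x y * f y) @[x --> 0^'+] --> 0.
Proof.
move=> intf.
have [m01 _] := lebesgue_measure_itv_fin 0 1 true false ler01.
have [g_ [cg ig gf]] :=
  approximation_continuous_integrable (measurable_itv _) m01 intf.
apply/cvgrPdist_le => e e0.
have [n fg] : exists n, \int[mu]_(y in `[0, 1]) `|f y - g_ n y| <= e.
  have /fine_cvg/cvgrPdist_le/(_ _ e0) [n _ H] := gf.
  exists n; have := H n (leqnn n); rewrite sub0r normrN /= /Rintegral.
  by apply: le_trans; exact: ler_norm.
have /cvgrPdist_le/(_ _ (divr_gt0 e0 (ltr0Sn _ 1))) :=
  cvg_Kker_continuous _ (cg n).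
apply: filterS => x; rewrite !sub0r !normrN => Kg.
have iK (h : R -> R) : mu.-integrable `[0, 1] (EFin \o h) ->
    mu.-integrable `[0, 1] (EFin \o (fun y => Kker x y * h y)).
  apply: integrable_mul_bounded => //; last exact: normr_Kker_le.
  by apply: measurable_funTS; exact: measurable_Kker.
have ifg : mu.-integrable `[0, 1] (EFin \o (fun y => f y - g_ n y)).
  exact: integrableB intf (ig n).
have -> : \int[mu]_(y in `[0, 1]) (Kker x y * f y) =
    \int[mu]_(y in `[0, 1]) (Kker x y * (f y - g_ n y)) +
    \int[mu]_(y in `[0, 1]) (Kker x y * g_ n y).
  rewrite -RintegralD//; [|exact: iK|exact/iK/ig].
  by apply: eq_Rintegral => y _; ring.
apply: (le_trans (ler_normD _ _)).
rewrite [leRHS]splitr; apply: lerD Kg; rewrite mulrC.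
apply: le_trans; first by apply: le_normr_Rintegral => //; exact: iK ifg.
apply: (@le_trans _ _ (2^-1 * \int[mu]_(y in `[0, 1]) `|f y - g_ n y|)).
  rewrite -RintegralZl//; last exact: integrable_norm.
  apply: le_Rintegral => //.
  - exact/integrable_norm/iK.
  - exact: (@integrableZl _ _ _ mu `[0, 1] (measurable_itv _) 2^-1 _
      (integrable_norm ifg)).
  - by move=> y _; rewrite normrM ler_wpM2r// normr_Kker_le.
by rewrite ler_wpM2l.
Qed.

End riemann_lebesgue.

(** * Continuity of the integral transform and of the eigenfunctions *)

Section eigenfunctions.
Context {R : realType}.

Local Notation leb_type := (caratheodory_type (R:=R) (@wlength R idfun)^*%mu).
Local Notation cmu := (@completed_lebesgue_measure R).
Local Notation unit_itv := (`[0%R, 1%R]%classic : set leb_type).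

Lemma measurable_unit_itv : measurable unit_itv.
Proof. by apply: measurable_completed; exact: measurable_itv. Qed.

Lemma completed_unit_itv_fin : (cmu unit_itv < +oo)%E.
Proof. exact: (lebesgue_measure_itv_fin 0 1 true false ler01).1. Qed.

(** On a set of finite measure [1 + phi ^+ 2] is integrable, and it dominates [|phi|] because the
    squares of [phi + 1/2] and [phi - 1/2] are nonnegative. *)
Lemma integrable_of_square (phi : leb_type -> R) :
  measurable_fun unit_itv phi ->
  cmu.-integrable unit_itv (fun y => (phi y ^+ 2)%:E) ->
  cmu.-integrable unit_itv (EFin \o phi).
Proof.
move=> mphi iphi2.
have ic : cmu.-integrable unit_itv (EFin \o cst 1).
  apply: measurable_bounded_integrable => //.
  - exact: measurable_unit_itv.
  - exact: completed_unit_itv_fin.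
  - by exists `|1|; split; [exact: num_real|move=> c lc t _; exact: ltW].
apply: (le_integrable measurable_unit_itv _ _
  (integrableD measurable_unit_itv ic iphi2)).
  exact/measurable_EFinP.
move=> y _ /=; rewrite lee_fin ler_normr; apply/orP; left.
rewrite ler_norml; apply/andP; split.
  by have := sqr_ge0 (phi y + 2^-1); lra.
by have := sqr_ge0 (phi y - 2^-1); lra.
Qed.

Lemma integrable_Kker (phi : leb_type -> R) (x : R) :
  cmu.-integrable unit_itv (EFin \o phi) ->
  cmu.-integrable unit_itv (EFin \o (fun y => Kker x y * phi y)).
Proof.
apply: integrable_mul_bounded; first exact: measurable_unit_itv.
  apply: measurable_fun_completed; first exact: measurable_itv.
  by apply: measurable_funTS; exact: measurable_Kker.
exact: normr_Kker_le.
Qed.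

(** Taken on the whole line rather than on $[0,1]$: the kernel vanishes for nonpositive [x], so
    continuity at [0] reduces to a limit from the right. *)
Definition Ktransform (phi : R -> R) (x : R) : R :=
  Rintegral cmu unit_itv (fun y => Kker x y * phi y).

Lemma Ktransform_le0 (phi : R -> R) (x : R) : x <= 0 -> Ktransform phi x = 0.
Proof.
move=> x0; rewrite /Ktransform.
under eq_Rintegral do rewrite Kker_le0// mul0r.
by rewrite Rintegral_cst ?mul0r//; exact: measurable_unit_itv.
Qed.

Variable phi : R -> R.
Hypothesis iphi : cmu.-integrable unit_itv (EFin \o phi).

Lemma normr_Ktransform_le (x : R) :
  `|Ktransform phi x| <= Rintegral cmu unit_itv (fun y => `|phi y|).
Proof.
apply: le_trans.
  apply: le_normr_Rintegral; [exact: measurable_unit_itv|exact: integrable_Kker].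
apply: le_Rintegral.
- exact: measurable_unit_itv.
- exact/integrable_norm/integrable_Kker.
- exact: integrable_norm.
- move=> y _; rewrite normrM ler_piMl// (le_trans (normr_Kker_le _ _))//; lra.
Qed.

(** Dominated convergence along sequences, with majorant [|phi|]. The exceptional set of [y] depends
    only on the limit [x], not on the sequence, and is countable, hence negligible. *)
Lemma continuous_Ktransform_gt0 (x : R) : 0 < x ->
  {for x, continuous (Ktransform phi)}.
Proof.
move=> x0; apply/(@cvg_nbhsP _ R^o) => u ux.
have mK z : measurable_fun unit_itv (fun y => (Kker z y * phi y)%:E).
  by case/integrableP : (integrable_Kker phi z iphi).
have cA : countable (range (fun k : int => (x * k%:~R)^-1)).
  by apply: card_le_trans (card_image_le _ _) _; exact: countableP.
have aeK : {ae cmu, forall y, unit_itv y ->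
    (Kker (u n) y * phi y)%:E @[n --> \oo] --> (Kker x y * phi y)%:E}.
  apply: negligibleS (completed_countable0 _ cA) => y /= ncvg.
  apply: contrapT => yA; apply: ncvg => _; apply: cvg_EFin; first exact: nearW.
  apply: cvgM; last exact: cvg_cst.
  apply: cvg_Kkerl => // k; apply/eqP => yE; apply: yA.
  by exists k.
have aeB : {ae cmu, forall y n, unit_itv y ->
    (`|(Kker (u n) y * phi y)%:E| <= `|phi y|%:E)%E}.
  apply: aeW => y n _; rewrite lee_fin normrM ler_piMl//.
  by rewrite (le_trans (normr_Kker_le _ _))//; lra.
have [_ _] := @dominated_convergence _ leb_type R cmu unit_itv
  measurable_unit_itv (fun n y => (Kker (u n) y * phi y)%:E)
  (fun y => (Kker x y * phi y)%:E) (fun y => `|phi y|%:E)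
  (fun n => mK (u n)) (mK x) aeK (integrable_norm iphi) aeB.
have -> : (\int[cmu]_(y in unit_itv) (Kker x y * phi y)%:E)%E =
    (Ktransform phi x)%:E.
  rewrite fineK//; apply: integrable_fin_num; first exact: measurable_unit_itv.
  exact: integrable_Kker.
exact: fine_cvg.
Qed.

(** The transform is zero on the nonpositive half-line and continuous on the open positive one. *)
Lemma measurable_Ktransform : measurable_fun [set: R] (Ktransform phi).
Proof.
rewrite -set_itvNyy (@itv_bndbnd_setU _ _ _ (BRight 0))//.
apply/measurable_funU => //; split.
  apply: (@eq_measurable_fun _ _ R R _ (cst 0)) => // x.
  rewrite inE/= in_itv/= => x0.
  by rewrite Ktransform_le0.
apply: open_continuous_measurable_fun; first exact: interval_open.
move=> x; rewrite inE/= in_itv/= andbT; exact: continuous_Ktransform_gt0.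
Qed.

(* The eigenfunction is merely Lebesgue measurable, but its transform is Borel
   and bounded, so the equation [T = lam K T] can be read for Borel functions. *)
Lemma cvg_Ktransform0 (lam : R) :
  (forall x, x \in `[0, 1] -> phi x = lam * Ktransform phi x) ->
  Ktransform phi x @[x --> 0^'+] --> 0.
Proof.
move=> phiE; set T := Ktransform phi.
have bT D : [bounded T x | x in D].
  exists (Rintegral cmu unit_itv (fun y => `|phi y|)).
  split; first exact: num_real.
  by move=> c lc x _; apply: le_trans (normr_Ktransform_le x) _; exact: ltW.
have mT := measurable_Ktransform.
have iT : cmu.-integrable unit_itv (EFin \o T).
  apply: measurable_bounded_integrable => //.
  - exact: measurable_unit_itv.
  - exact: completed_unit_itv_fin.
  - apply: measurable_fun_completed; first exact: measurable_itv.
    exact: measurable_funTS.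
have iT' : lebesgue_measure.-integrable `[0, 1] (EFin \o T).
  apply: measurable_bounded_integrable => //.
  - exact: completed_unit_itv_fin.
  - exact: measurable_funTS.
(* Substituting [lam * T] for [phi] under the integral makes the integrand Borel, so the completed
   measure can be exchanged for the Borel one. *)
have TE x : T x = lam * \int[lebesgue_measure]_(y in `[0, 1]) (Kker x y * T y).
  rewrite -Rintegral_completed//.
  - rewrite -RintegralZl; last 2 first.
    + exact: measurable_unit_itv.
    + exact: integrable_Kker.
    apply: eq_Rintegral => y; rewrite inE => y01.
    by rewrite (phiE y y01) mulrCA.
  - by apply: measurable_funM => //; exact: measurable_Kker.
  - exact: integrable_Kker.
rewrite (funext TE) -[X in _ --> X](mulr0 lam).
by apply: cvgM; [exact: cvg_cst|exact: cvg_Kker_integrable].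
Qed.

End eigenfunctions.

Theorem theorem2p10 (R : realType) (phi : R -> R) (lam : R) :
  is_eigenfunction phi lam -> {within `[0%R, 1%R], continuous phi}.
Proof.
case=> mphi iphi2 _ phiE.
have iphi := integrable_of_square phi (measurable_fun_LebR _ _ mphi) iphi2.
have {}phiE (x : R) : x \in `[0, 1] -> phi x = lam * Ktransform phi x.
  exact: phiE.
have cT : continuous (Ktransform phi).
  move=> x; have [x0|x0|->] := ltgtP x 0.
  - apply: cvg_near_cst; apply: filterS (lt_nbhsl x0) => y y0.
    by rewrite !Ktransform_le0 ?ltW.
  - exact: continuous_Ktransform_gt0.
  (* To the left of [0] the transform is identically zero; the limit from the right is the
     Riemann-Lebesgue argument. *)
  - apply/left_right_continuousP; rewrite Ktransform_le0//; split.
    + apply: cvg_near_cst; apply: filterS (nbhs_left_lt 0) => y y0.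
      by rewrite Ktransform_le0 ?ltW.
    + exact: cvg_Ktransform0 phiE.
have : {within `[0%R, 1%R], continuous (fun x => lam * Ktransform phi x)}.
  apply: continuous_subspaceT => x; apply: cvgM; [exact: cvg_cst|exact: cT].
(* The eigenvalue equation holds on $[0,1]$ only, which is enough for the subspace topology. *)
by apply: subspace_eq_continuous => x; rewrite inE => x01; exact/esym/phiE.
Qed.
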